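(* Let $n\ge 1$ and $m\ge 0$ be integers, let $f$ be a field of characteristic $0$, and let $V$ be the $n$-dimensional $f$-vector space with basis $(x_1,\dots,x_n)$ on which $SL(n)$ (the group of $n\times n$ matrices over $f$ of determinant $1$) acts in the standard way. Then the tensors $t_G$, where $G$ ranges over all $n$-wave graphs with $m$ vertices, form a basis of the space of $SL(n)$-invariants in $V^{\otimes m}$.
   Context: $SL(n)$ acts on $V^{\otimes m}$ diagonally: $a\cdot(v_1\otimes\dots\otimes v_m)=av_1\otimes\dots\otimes av_m$. An $n$-wave graph with $m$ vertices is a simple graph with vertex set $\{1,2,\dots,m\}$, each connected component of which is a path of length $n-1$ (i.e. with $n$ vertices and $n-1$ edges) of the form $\{i_1,i_2\},\{i_2,i_3\},\dots,\{i_{n-1},i_n\}$ with $i_1<i_2<\dots<i_n$, such that the edges can be drawn without intersections in the book with $n-1$ pages, i.e. $n-1$ copies of the upper half-plane glued along $\mathbb{R}$ (the vertices being the points $1,\dots,m$ of $\mathbb{R}$), where for every component the $N$-th edge $\{i_N,i_{N+1}\}$ is drawn on the $N$-th page, $1\le N\le n-1$. Combinatorially, the last condition says: for each $N$ with $1\le N\le n-1$ there are no two components $i_1<\dots<i_n$ and $j_1<\dots<j_n$ with $i_N<j_N<i_{N+1}<j_{N+1}$. For an $n$-wave graph $G$, let $\mathcal{O}(G)$ be the set of all choices $g$ of a total ordering of the vertex set of each connected component of $G$ (so $|\mathcal{O}(G)|=(n!)^k$ if $m=kn$). For $g\in\mathcal{O}(G)$ and a vertex $i$, let $\mathrm{or}(i)\in\{1,\dots,n\}$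 be the ordinal number (position) of $i$ in the total ordering given by $g$ on the component containing $i$, and set $$b_g=x_{\mathrm{or}(1)}\otimes x_{\mathrm{or}(2)}\otimes\dots\otimes x_{\mathrm{or}(m)}\in V^{\otimes m}.$$ Let $\mathrm{inv}(g)$ be the number of pairs of vertices $i<j$ lying in the same component such that $j$ precedes $i$ in the ordering given by $g$. Then $$t_G=\sum_{g\in\mathcal{O}(G)}(-1)^{\mathrm{inv}(g)}\,b_g .$$ *)

(* Defs.v *)
From mathcomp Require Import all_boot all_order all_algebra.

Set Implicit Arguments.
Unset Strict Implicit.
Unset Printing Implicit Defensive.

Import GRing.Theory.
Local Open Scope ring_scope.

(* V is ['cV[F]_n], and the m-th tensor power of V is given by coordinates: T w
   is the coefficient of x_(w 0) (x) ... (x) x_(w (m-1)) in T. *)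
Notation tensor F n m := {ffun {ffun 'I_m -> 'I_n} -> F^o}.

(* The basis vectors are numbered x_1, ..., x_n (and x_k = 0 for any other k),
   whereas the coordinates of a column vector are numbered from 0. *)
Definition xvec (F : fieldType) (n k : nat) : 'cV[F]_n :=
  \col_(i < n) (i.+1 == k)%:R.

Definition pure_tensor (F : fieldType) (n m : nat) (v : 'I_m -> 'cV[F]_n) :
    tensor F n m :=
  [ffun w : {ffun 'I_m -> 'I_n} => \prod_(k < m) v k (w k) 0].

Definition tensor_act (F : fieldType) (n m : nat) (a : 'M[F]_n)
    (T : tensor F n m) : tensor F n m :=
  \sum_(u : {ffun 'I_m -> 'I_n})
     T u *: pure_tensor (fun k => a *m xvec F n (u k).+1).

Lemma tensor_act_linear (F : fieldType) (n m : nat) (a : 'M[F]_n) :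
  linear (@tensor_act F n m a).
Proof.
move=> c S T; rewrite /tensor_act scaler_sumr -big_split /=.
by apply: eq_bigr => u _; rewrite !ffunE scalerDl scalerA.
Qed.

Lemma mulmx_xvec (F : fieldType) (n : nat) (a : 'M[F]_n) (j i : 'I_n) :
  (a *m xvec F n j.+1) i 0 = a i j.
Proof.
rewrite mxE (bigD1 j) //= mxE eqxx mulr1 big1 ?addr0 // => l l_j.
by rewrite mxE eqSS (inj_eq val_inj) (negPf l_j) mulr0.
Qed.

(* Together with linearity, this characterizes [tensor_act] as the diagonal
   action. *)
Lemma tensor_act_pure (F : fieldType) (n m : nat) (a : 'M[F]_n)
    (v : 'I_m -> 'cV[F]_n) :
  tensor_act a (pure_tensor v) = pure_tensor (fun k => a *m v k).
Proof.
apply/ffunP => w; rewrite ffunE sum_ffunE.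
under [RHS]eq_bigr do rewrite mxE.
rewrite bigA_distr_bigA; apply: eq_bigr => u _.
rewrite !ffunE /GRing.scale /= -big_split; apply: eq_bigr => k _ /=.
by rewrite mulmx_xvec mulrC.
Qed.

Definition SL_invariant (F : fieldType) (n m : nat) (T : tensor F n m) : Prop :=
  forall a : 'M[F]_n, \det a = 1 -> tensor_act a T = T.

Notation graph m := {set {set 'I_m}}.

Definition simple_graph (m : nat) (G : graph m) : bool :=
  [forall e in G, #|e| == 2].

Definition adj (m : nat) (G : graph m) : rel 'I_m :=
  fun i j => [set i; j] \in G.

Definition same_comp (m : nat) (G : graph m) : rel 'I_m := connect (adj G).

Definition components (m : nat) (G : graph m) : {set {set 'I_m}} :=
  [set [set j | same_comp G i j] | i : 'I_m].

(* s lists the vertices of C from left to right; the last condition says that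
   the edges of G inside C are exactly the pairs {s_N, s_(N+1)}. *)
Definition path_component (n m : nat) (G : graph m) (C : {set 'I_m})
    (s : n.-tuple 'I_m) : bool :=
  [&& C \in components G,
      C == [set i in s],
      sorted (fun i j : 'I_m => (i < j)%N) s
    & [set e in G | e \subset C] ==
      [set [set tnth s p.1; tnth s p.2]
         | p in [set p : 'I_n * 'I_n | p.2 == p.1.+1 :> nat]]].

(* The arcs {s_N, s_(N+1)} and {t_N, t_(N+1)}, both drawn on the same page, do
   not cross in this order; the other order is obtained by exchanging s and t. *)
Definition noncrossing (n m : nat) (s t : n.-tuple 'I_m) : bool :=
  [forall N : 'I_n, forall N' : 'I_n, (N' == N.+1 :> nat) ==>
     ~~ [&& (tnth s N < tnth t N)%N, (tnth t N < tnth s N')%N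
          & (tnth s N' < tnth t N')%N]].

Definition wave_graph (n m : nat) (G : graph m) : bool :=
  [&& simple_graph G,
      [forall C in components G, exists s : n.-tuple 'I_m,
         path_component G C s]
    & [forall C, forall D, forall s : n.-tuple 'I_m, forall t : n.-tuple 'I_m,
         path_component G C s && path_component G D t ==> noncrossing s t]].

(* A choice of a (non-strict) total order on each component is encoded as the
   union of these orders, a set of pairs of vertices in the same component:
   (i, j) \in g means that i = j or i precedes j. *)
Definition orderings (m : nat) (G : graph m) : {set {set 'I_m * 'I_m}} :=
  [set g : {set 'I_m * 'I_m} |
    [&& [forall i, forall j, ((i, j) \in g) ==> same_comp G i j],
        [forall i, (i, i) \in g],
        [forall i, forall j, ((i, j) \in g) && ((j, i) \in g) ==> (i == j)],
        [forall i, forall j, forall k,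
           ((i, j) \in g) && ((j, k) \in g) ==> ((i, k) \in g)]
      & [forall i, forall j,
           same_comp G i j ==> ((i, j) \in g) || ((j, i) \in g)]]].

(* The position, counted from 1, of i in the order on its component. *)
Definition ordinal_number (m : nat) (g : {set 'I_m * 'I_m}) (i : 'I_m) : nat :=
  #|[set j | (j, i) \in g]|.

Definition inversions (m : nat) (G : graph m) (g : {set 'I_m * 'I_m}) : nat :=
  #|[set p : 'I_m * 'I_m |
      [&& (p.1 < p.2)%N, same_comp G p.1 p.2 & (p.2, p.1) \in g]]|.

Definition b_tensor (F : fieldType) (n m : nat) (g : {set 'I_m * 'I_m}) :
    tensor F n m :=
  pure_tensor (fun i => xvec F n (ordinal_number g i)).

Definition t_tensor (F : fieldType) (n m : nat) (G : graph m) : tensor F n m :=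
  \sum_(g in orderings G) (-1) ^+ inversions G g *: b_tensor F n g.

(* Main.v *)
Require Import Defs.
From mathcomp Require Import all_boot all_order all_algebra.
From mathcomp Require Import fingroup perm zify.

Set Implicit Arguments.
Unset Strict Implicit.
Unset Printing Implicit Defensive.

Import Order.TTheory GRing.Theory Num.Theory.
Local Open Scope ring_scope.

(** A tensor is a function on words w : 'I_m -> 'I_n, and everything rests on
    the lexicographic order of words.

    Writing 0, 1, ..., n-1 along each component of a wave graph G, from left to
    right, gives its label word.  The coefficient of t_G at w vanishes unless w
    is injective on each component, and then it is the sign of the number of
    inversions ([t_tensorE]).  So t_G is a product of n x n determinants, one
    per component, hence it is invariant ([t_tensor_invariant]).  Moreover a
    word in the support of t_G that first departs from the label word at a
    vertex i has there a letter larger than the label, because the smaller ones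
    are taken by the earlier vertices of the component: the label word is the
    lexicographically least word of t_G, with coefficient 1
    ([t_tensor_label], [t_tensor_support]).

    The label word determines the wave graph: call N an opening and N+1 a
    closing bracket; without crossings on page N, the edges of that page must
    join matching brackets ([chain_graph_dyck]).  Conversely, if w contains
    every letter equally often and no prefix contains N+1 more often than N,
    then matching the brackets on all pages yields a wave graph with label word
    w ([lattice_chains]).  Such words are the lattice words, which correspond to
    standard tableaux of rectangular shape.

    The t_G are therefore triangular, hence free ([triangular_free]).  They
    span because the least word w in the support of any nonzero invariant T is
    such a lattice word; subtracting T(w) t_G, where G has label word w, removes w
    from the support, and one concludes by induction ([triangular_span]).
    That each letter occurs equally often in w follows from invariance under
    diag(2, 1/2) acting on two consecutive basis vectors; this is where
    characteristic 0 is used ([invariant_balanced]).  The condition on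
    prefixes follows from invariance under a single transvection
    ([lexmin_lattice]). *)

(** * Occurrences of letters in intervals *)

Definition occ (n m : nat) (w : {ffun 'I_m -> 'I_n}) (r a b : nat) : nat :=
  (\sum_(p < m) [&& w p == r :> nat, a <= p & p < b])%N.

Lemma occ_cat n m (w : {ffun 'I_m -> 'I_n}) r a b c : (a <= b <= c)%N ->
  occ w r a c = (occ w r a b + occ w r b c)%N.
Proof.
by move=> abc; rewrite /occ -big_split; apply: eq_bigr => p _ /=; lia.
Qed.

(** * The support of an invariant tensor *)

Section TensorAction.
Variables (F : fieldType) (n m : nat).
Implicit Types (T : tensor F n m) (a : 'M[F]_n).

Lemma tensor_actE a T w :
  tensor_act a T w = \sum_u T u * \prod_(k < m) a (w k) (u k).
Proof.
rewrite sum_ffunE; apply: eq_bigr => u _; rewrite !ffunE; congr (_ * _).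
by apply: eq_bigr => k _; rewrite mulmx_xvec.
Qed.

Lemma tensor_act_sum (I : finType) (P : pred I) (c : I -> F)
    (S : I -> tensor F n m) a :
  tensor_act a (\sum_(i | P i) c i *: S i) =
  \sum_(i | P i) c i *: tensor_act a (S i).
Proof.
elim/big_rec2: _ => [|i U T _ <-]; last exact: tensor_act_linear.
by rewrite /tensor_act big1 // => u _; rewrite ffunE scale0r.
Qed.

(** Letting a different matrix act on each tensor factor makes it possible to
    read off one coefficient of a tensor after a partial summation. *)
Definition multi_act (B : 'I_m -> 'M[F]_n) T : tensor F n m :=
  [ffun w : {ffun 'I_m -> 'I_n} => \sum_u T u * \prod_(k < m) B k (w k) (u k)].

Lemma multi_act_comp (A B : 'I_m -> 'M[F]_n) T :
  multi_act B (multi_act A T) = multi_act (fun k => B k *m A k) T.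
Proof.
apply/ffunP => w; rewrite !ffunE.
under eq_bigr => u _ do rewrite ffunE big_distrl /=.
rewrite exchange_big /=; apply: eq_bigr => u _.
under eq_bigr => v _ do rewrite -mulrA -big_split /=.
rewrite -big_distrr /=; congr (_ * _).
under [RHS]eq_bigr => k _ do rewrite mxE.
rewrite bigA_distr_bigA; apply: eq_bigr => v _; apply: eq_bigr => k _.
by rewrite mulrC.
Qed.

Lemma tensor_act_multi a T : tensor_act a T = multi_act (fun=> a) T.
Proof. by apply/ffunP => w; rewrite tensor_actE ffunE. Qed.

Lemma multi_act_eq0 (B : 'I_m -> 'M[F]_n) T (w : {ffun 'I_m -> 'I_n}) :
  (forall u : {ffun 'I_m -> 'I_n},
     T u != 0 -> (forall k, B k (w k) (u k) != 0) -> False) ->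
  multi_act B T w = 0.
Proof.
move=> H; rewrite ffunE big1 // => u _; apply/eqP/negP => /negP.
rewrite mulf_eq0 negb_or => /andP[Tu /prodf_neq0 Bu]; apply: (H u) => // k.
exact: Bu.
Qed.

Lemma multi_act_single (B : 'I_m -> 'M[F]_n) T (w : {ffun 'I_m -> 'I_n}) :
  (forall k, B k (w k) (w k) = 1) ->
  (forall u : {ffun 'I_m -> 'I_n},
     T u != 0 -> (forall k, B k (w k) (u k) != 0) -> u = w) ->
  multi_act B T w = T w.
Proof.
move=> B1 H; rewrite ffunE (bigD1 w) //= big1 ?mulr1 => [|k _]; last exact: B1.
rewrite big1 ?addr0 // => u uw; apply/eqP/negP => /negP.
rewrite mulf_eq0 negb_or => /andP[Tu /prodf_neq0 Bu].
by rewrite (H u) ?eqxx // in uw => k; apply: Bu.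
Qed.

Definition lexlt (u w : {ffun 'I_m -> 'I_n}) : Prop :=
  exists2 k : 'I_m, (forall j : 'I_m, (j < k)%N -> u j = w j) & (u k < w k)%N.

Definition balanced (w : {ffun 'I_m -> 'I_n}) :=
  forall r, (r.+1 < n)%N -> occ w r 0 m = occ w r.+1 0 m.

(** Equivalently, writing 1, 2, ... successively at the end of the rows w 0,
    w 1, ... yields a standard Young tableau. *)
Definition lattice (w : {ffun 'I_m -> 'I_n}) :=
  forall r t, (r.+1 < n)%N -> (occ w r.+1 0 t <= occ w r 0 t)%N.

Lemma occ_total (w : {ffun 'I_m -> 'I_n}) r t :
  (m <= t)%N -> occ w r 0 t = occ w r 0 m.
Proof. by move=> ht; apply: eq_bigr => p _; have := ltn_ord p; lia. Qed.

(** Suppose that in the prefix of length t of w there are more letters r+1 than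
    r; then in the remaining suffix there are more letters r than r+1.  Sum the
    coefficients of T over the words obtained from w by changing any letters r
    of the suffix into r+1: by balance only T(w) survives.  The same sum, applied
    to the image of T under the transvection a that sends x_r to x_r - x_(r+1),
    involves only words u that, on the prefix, are pointwise at most w, hence
    agree with w by minimality, and that, on the suffix, have an r only where w
    has r+1 and an r+1 wherever w has r.  Such a u has too few letters r to be
    balanced, so T(w) = 0. *)
Lemma lexmin_lattice T w :
  SL_invariant T -> (forall u, T u != 0 -> balanced u) ->
  T w != 0 -> (forall u, T u != 0 -> ~ lexlt u w) -> lattice w.
Proof.
move=> invT balT Tw minw r t rn; rewrite leqNgt; apply/negP => bad.
have tm : (t <= m)%N.
  rewrite leqNgt; apply/negP => mt; move: bad.
  by rewrite !occ_total ?(ltnW mt) // (balT _ Tw r rn) ltnn.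
pose i := Ordinal (ltnW rn); pose i' := Ordinal rn.
pose a : 'M[F]_n := 1%:M - delta_mx i' i.
pose S : 'M[F]_n := 1%:M + delta_mx i i'.
have ii' : (i == i') = false by apply/eqP => /(congr1 val) /=; lia.
have ra x y : a x y = (x == y)%:R - ((x == i') && (y == i))%:R by rewrite !mxE.
have rS x y : S x y = (x == y)%:R + ((x == i) && (y == i'))%:R by rewrite !mxE.
have rSa x y : (S *m a) x y = (x == y)%:R + ((x == i) && (y == i'))%:R
    - ((x == i') && (y == i))%:R - ((x == i) && (y == i))%:R.
  rewrite mulmxDl mul1mx mulmxBr mulmx1 mul_delta_mx !mxE.
  by rewrite addrA; congr (_ - _); rewrite addrAC.
have deta : \det a = 1.
  rewrite det_trig ?big1 // => [x _|].
    rewrite ra eqxx; case: eqP => [->|]; last by rewrite subr0.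
    by rewrite [i' == i]eq_sym ii' subr0.
  apply/is_trig_mxP => x y xy; rewrite ra.
  have /negPf-> : x != y by apply/eqP => xy'; rewrite xy' ltnn in xy.
  case: eqP => [xi|]; last by rewrite subr0.
  case: eqP => [yi|]; last by rewrite subr0.
  by move: xy; rewrite xi yi /= ltnNge leqnSn.
pose B (k : 'I_m) : 'M[F]_n := if (k < t)%N then 1%:M else S.
have nz (b : bool) : (b%:R != 0 :> F) -> b by case: b; rewrite ?eqxx.
(* S adds row r+1 to row r: this sums over the ways to turn r into r+1. *)
have E1 : multi_act B T w = T w.
  apply: multi_act_single => [k|u Tu Bu].
    rewrite /B; case: ifP => _; first by rewrite mxE eqxx.
    by rewrite rS eqxx; case: (w k =P i) => [->|]; rewrite ?ii' ?addr0.
  have Hu k : u k = w k \/ (w k = i /\ u k = i').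
    move: (Bu k); rewrite /B; case: ifP => _.
      by rewrite mxE => /nz /eqP->; left.
    rewrite rS; case: (w k =P u k) => [->|_]; first by left.
    by rewrite add0r => /nz /andP[/eqP-> /eqP->]; right.
  have := balT _ Tu r rn; have := balT _ Tw r rn => bw bu.
  apply/ffunP => k0; case: (Hu k0) => // -[wk0 uk0].
  have l1 : (occ w r.+1 0 m <= occ u r.+1 0 m)%N.
    apply: leq_sum => k _; case: (Hu k) => [->//|[-> ->]] /=.
    by rewrite eqxx; case: (r == _) (leq0n k) (ltn_ord k); rewrite /= ?ltn_ord.
  have l2 : (occ u r 0 m < occ w r 0 m)%N.
    rewrite /occ (bigD1 k0) //= [ltnRHS](bigD1 k0) //= wk0 uk0 /= eqxx ltn_ord.
    have /negPf-> : r.+1 != r by lia.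
    rewrite /= add0n ltnS; apply: leq_sum => k _; case: (Hu k) => [->//|[-> ->]] /=.
    by have /negPf-> : r.+1 != r by lia.
  by move: l1 l2; rewrite bw bu; lia.
case/eqP: (Tw); rewrite -E1 -(invT a deta) tensor_act_multi multi_act_comp.
apply: multi_act_eq0 => u Tu Bu.
have pre (k : 'I_m) : (k < t)%N -> u k = w k.
  have Hle (j : 'I_m) : (j < t)%N -> (u j <= w j)%N.
    move=> jt; move: (Bu j); rewrite /B jt mul1mx ra.
    case: (w j =P u j) => [->//|_]; rewrite add0r oppr_eq0.
    by move=> /nz /andP[/eqP-> /eqP->] /=.
  have [k0] := ubnP (k : nat); elim: k0 k => // k0 IH k kk0 kt.
  apply/val_inj/eqP; rewrite eqn_leq Hle //= leqNgt; apply/negP => lt.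
  apply: (minw u Tu); exists k => // j jk; apply: IH; lia.
have suf (k : 'I_m) : (t <= k)%N ->
   (u k == i -> w k == i') /\ (w k == i -> u k == i').
  move=> tk; move: (Bu k); rewrite /B ltnNge tk /= rSa => H; split => /eqP E.
    apply: contraNT H => /negPf W; rewrite E W ii' eqxx andbF andbT /= addr0.
    by rewrite subr0 andbT subrr.
  apply: contraNT H => /negPf W; rewrite E W ii' eqxx andbF /= addr0 subr0.
  by rewrite [u k == i]eq_sym subrr.
have bw := balT _ Tw r rn; have bu := balT _ Tu r rn.
have c1 : (occ u r t m <= occ w r.+1 t m)%N.
  apply: leq_sum => k _; case: (leqP t k) => [tk|]; last by rewrite andbF.
  have [H _] := suf k tk; move: H; rewrite -!val_eqE /=.
  by case: (_ == r) => // ->.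
have c2 : (occ w r t m <= occ u r.+1 t m)%N.
  apply: leq_sum => k _; case: (leqP t k) => [tk|]; last by rewrite andbF.
  have [_ H] := suf k tk; move: H; rewrite -!val_eqE /=.
  by case: (_ == r) => // ->.
have c3 x : occ u x 0 t = occ w x 0 t.
  apply: eq_bigr => k _; case: (ltnP k t) => [kt|]; last by rewrite !andbF.
  by rewrite pre.
move: bw bu; rewrite !(@occ_cat _ _ _ _ 0 t m) ?tm // !c3; lia.
Qed.

Lemma natf_inj (charF0 : [pchar F] =i pred0) (k l : nat) :
  k%:R = l%:R :> F -> k = l.
Proof.
move=> kl; wlog le : k l kl / (k <= l)%N.
  by move=> H; case/orP: (leq_total k l) => /H; [apply | move/(_ (esym kl))->].
apply/eqP; rewrite eqn_leq le /= -subn_eq0.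
by rewrite -((pcharf0P F).1 charF0) natrB // kl subrr.
Qed.

(** The torus element with entries 2 and 1/2 at r and r+1 multiplies T(w) by
    2 to the power (number of r) - (number of r+1). *)
Lemma invariant_balanced (charF0 : [pchar F] =i pred0) T
    (w : {ffun 'I_m -> 'I_n}) :
  SL_invariant T -> T w != 0 -> balanced w.
Proof.
move=> invT Tw r rn.
pose i := Ordinal (ltnW rn); pose i' := Ordinal rn.
have ii' : (i == i') = false by apply/eqP => /(congr1 val) /=; lia.
have two0 : 2%:R != 0 :> F by rewrite ((pcharf0P F).1 charF0).
pose d : 'rV[F]_n := \row_j (if j == i then 2%:R else if j == i' then 2%:R^-1 else 1).
have detd : \det (diag_mx d) = 1.
  rewrite det_diag (bigD1 i) //= (bigD1 i') /=; last by rewrite eq_sym ii'.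
  rewrite !mxE eqxx [i' == i]eq_sym ii' eqxx big1 ?mulr1 ?divff //.
  by move=> j /andP[/negPf ji /negPf ji']; rewrite mxE ji ji'.
have := congr1 (fun S : tensor F n m => S w) (invT _ detd).
rewrite /= tensor_actE (bigD1 w) //= [X in _ + X]big1 ?addr0; last first.
  move=> u uw; suff [k uk] : exists k : 'I_m, w k != u k.
    by rewrite (bigD1 k) //= mxE (negPf uk) mulr0n mul0r mulr0.
  apply/existsP; rewrite -negb_forall; apply: contra uw => /forallP H.
  by apply/eqP/ffunP => k; apply/esym/eqP/H.
move=> E; have {E} E : \prod_(k < m) diag_mx d (w k) (w k) = 1.
  by apply: (mulfI Tw); rewrite mulr1.
have P (j : nat) : 2%:R ^+ occ w j 0 m =
    \prod_(k < m) (if (w k : nat) == j then 2%:R else 1) :> F.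
  rewrite (big_morph _ (exprD _) (expr0 _)).
  by apply: eq_bigr => k _; rewrite ltn_ord andbT; case: eqP.
apply/eqP; rewrite -(eqn_exp2l _ _ (isT : 1 < 2)%N); apply/eqP.
apply: (natf_inj charF0); rewrite !natrX !P.
have Q0 : \prod_(k < m) (if (w k : nat) == r.+1 then 2%:R else 1) != 0 :> F.
  by apply/prodf_neq0 => k _; case: ifP; rewrite ?oner_neq0.
apply: (mulIf (invr_neq0 Q0)); rewrite divff // -[RHS]E -prodfV -big_split /=.
apply: eq_bigr => k _; rewrite !mxE eqxx -!val_eqE /= mulr1n.
case: (eqVneq (w k : nat) r) => [->|_].
  by rewrite ifN ?invr1 ?mulr1 //; lia.
by case: eqP; rewrite ?invr1 mul1r.
Qed.

End TensorAction.

(** * Signs of words and products of determinants *)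

Definition word_sign (n : nat) (v : 'I_n -> 'I_n) : int :=
  \prod_(r < n) \prod_(s < n | (r < s)%N) Num.sg ((v s)%:Z - (v r)%:Z).

(** Both sides compare the Vandermonde determinant of s(0), ..., s(n-1) with the
    positive one of 0, ..., n-1. *)
Lemma word_sign_perm n (s : 'S_n) : word_sign s = (-1) ^+ s.
Proof.
have VE (v : 'I_n -> 'I_n) :
    word_sign v = Num.sg (\det (Vandermonde n (\row_j (v j)%:Z))).
  rewrite det_Vandermonde /word_sign.
  rewrite (big_morph _ (@sgrM _) (@sgr1 _)); apply: eq_bigr => r _.
  rewrite (big_morph _ (@sgrM _) (@sgr1 _)); apply: eq_bigr => q _.
  by rewrite !mxE.
have -> : word_sign s = (-1) ^+ s * word_sign (id : 'I_n -> 'I_n).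
  rewrite !VE.
  suff -> : Vandermonde n (\row_j (s j)%:Z) =
            Vandermonde n (\row_j (j : nat)%:Z) *m perm_mx s^-1.
    rewrite det_mulmx det_perm odd_permV sgrM mulrC; congr (_ * _).
    by rewrite sgrX sgrN1.
  by rewrite -col_permE; apply/matrixP => i j; rewrite !mxE.
rewrite [X in _ * X]big1 ?mulr1 // => r _; rewrite big1 // => q rq.
by rewrite gtr0_sg // subr_gt0 ltz_nat.
Qed.

Lemma word_sign_eq0 n (v : 'I_n -> 'I_n) (r q : 'I_n) :
  r != q -> v r = v q -> word_sign v = 0.
Proof.
wlog lt_rq : r q / (r < q)%N.
  move=> H rq vrq; case: (ltngtP r q) => [rq'|rq'|/val_inj rq'].
  - exact: (H r q).
  - by apply: (H q r) => //; rewrite eq_sym.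
  - by rewrite rq' eqxx in rq.
move=> _ vrq.
by rewrite /word_sign (bigD1 r) //= (bigD1 q) //= vrq subrr sgr0 !mul0r.
Qed.

Lemma det_word (R : comPzRingType) n (v : 'I_n -> 'I_n) :
  \det (\matrix_(r, l) (v r == l)%:R) = (word_sign v)%:~R :> R.
Proof.
case: (boolP (injectiveb v)) => [/injectiveP vI | /injectivePn[r [q rq vrq]]].
  have vE : v =1 perm vI by move=> r; rewrite permE.
  have -> : word_sign v = word_sign (perm vI).
    by apply: eq_bigr => r _; apply: eq_bigr => q _; rewrite !vE.
  rewrite word_sign_perm -[RHS]/(_%:~R) rmorphXn rmorphN1 -det_perm; congr (\det _).
  by apply/matrixP => r l; rewrite !mxE vE.
rewrite (word_sign_eq0 rq vrq) (determinant_alternate rq) // => l.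
by rewrite !mxE vrq.
Qed.

Section Blocks.
Variables (F : fieldType) (n m : nat) (K : finType) (e : K -> n.-tuple 'I_m).
Hypothesis bij_e : bijective (fun p : K * 'I_n => tnth (e p.1) p.2).

Lemma big_chains (R : Type) (idx : R) (op : Monoid.com_law idx) (P : pred 'I_m)
    (E : 'I_m -> R) :
  \big[op/idx]_(i | P i) E i =
  \big[op/idx]_(c : K) \big[op/idx]_(r < n | P (tnth (e c) r)) E (tnth (e c) r).
Proof.
rewrite (reindex _ (onW_bij _ bij_e)) /=.
by rewrite (pair_big_dep xpredT (fun c r => P (tnth (e c) r)) (fun c r => E (tnth (e c) r))).
Qed.

(** By Leibniz' formula T is a signed sum of pure tensors; applying a to their
    factors multiplies each of the determinants by det a = 1. *)
Lemma block_det_invariant (T : tensor F n m) :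
  (forall w : {ffun 'I_m -> 'I_n},
     T w = \prod_(c : K) \det (\matrix_(r, l) (w (tnth (e c) r) == l)%:R)) ->
  SL_invariant T.
Proof.
move=> TE a deta.
have [e' eK e'K] := bij_e.
pose v (s : {ffun K -> 'S_n}) (i : 'I_m) := xvec F n (s (e' i).1 (e' i).2).+1.
have e'E c r : e' (tnth (e c) r) = (c, r) by apply: (eK (c, r)).
have expand (B : K -> 'M[F]_n) : \prod_c \det (B c) =
    \sum_(s : {ffun K -> 'S_n}) (\prod_c (-1) ^+ s c) *
       \prod_c \prod_r B c r (s c r).
  rewrite bigA_distr_bigA; apply: eq_bigr => s _; rewrite -big_split.
  by apply: eq_bigr.
have TS : T = \sum_(s : {ffun K -> 'S_n}) (\prod_c (-1) ^+ s c) *: pure_tensor (v s).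
  apply/ffunP => w; rewrite TE sum_ffunE expand; apply: eq_bigr => s _.
  rewrite !ffunE big_chains; congr (_ * _); apply: eq_bigr => c _.
  apply: eq_bigr => r _; rewrite !mxE /v e'E /= eqSS.
  by rewrite (inj_eq val_inj).
apply/ffunP => w; rewrite {1}TS tensor_act_sum sum_ffunE TE.
transitivity (\prod_c \det (\matrix_(r, l) a (w (tnth (e c) r)) l)).
  rewrite expand; apply: eq_bigr => s _.
  rewrite tensor_act_pure !ffunE big_chains; congr (_ * _).
  apply: eq_bigr => c _; apply: eq_bigr => r _.
  by rewrite mulmx_xvec e'E mxE.
apply: eq_bigr => c _; rewrite -[RHS]mulr1 -[X in _ = _ * X]deta -det_mulmx; congr (\det _).
apply/matrixP => r l; rewrite !mxE (bigD1 (w (tnth (e c) r))) //= mxE eqxx mulr1n mul1r.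
rewrite big1 ?addr0 // => j jw; rewrite mxE [_ == j]eq_sym (negPf jw) mul0r //.
Qed.

End Blocks.

(** * Wave graphs as systems of chains *)

Lemma same_comp_sym m (G : graph m) : connect_sym (adj G).
Proof. by apply: sym_connect_sym => i j; rewrite /adj setUC. Qed.

(** A family e of n-tuples of vertices, read as paths; K indexes the
    components. *)
Definition chain_graph (n m : nat) (K : finType) (e : K -> n.-tuple 'I_m) : graph m :=
  [set [set tnth (e x.1) x.2.1; tnth (e x.1) x.2.2]
     | x in [set x : K * ('I_n * 'I_n) | x.2.2 == x.2.1.+1 :> nat]].

Definition chain_system (n m : nat) (K : finType) (e : K -> n.-tuple 'I_m) : Prop :=
  [/\ bijective (fun p : K * 'I_n => tnth (e p.1) p.2),
      forall c, sorted (fun i j : 'I_m => (i < j)%N) (e c)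
    & forall c d, noncrossing (e c) (e d)].

Definition rank (m : nat) (G : graph m) (i : 'I_m) : nat :=
  #|[set j | same_comp G i j & (j < i)%N]|.

Section ChainSystem.
Variables (n m : nat) (K : finType) (e : K -> n.-tuple 'I_m).
Hypothesis sys_e : chain_system e.

Lemma chain_bij : bijective (fun p : K * 'I_n => tnth (e p.1) p.2).
Proof. by case: sys_e. Qed.

Lemma chain_vertex (i : 'I_m) : exists c r, i = tnth (e c) r.
Proof.
by have [e' _ e'K] := chain_bij; exists (e' i).1, (e' i).2; rewrite (e'K i).
Qed.

Lemma chain_inj c r d q : tnth (e c) r = tnth (e d) q -> c = d /\ r = q.
Proof.
by move=> H; have [-> ->] := bij_inj chain_bij (H : (fun p => tnth (e p.1) p.2) (c, r) =
    (fun p => tnth (e p.1) p.2) (d, q)).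
Qed.

Lemma chain_lt c r q : (tnth (e c) r < tnth (e c) q)%N = (r < q)%N.
Proof.
have lt (a b : 'I_n) : (a < b)%N -> (tnth (e c) a < tnth (e c) b)%N.
  move=> ab; pose x0 := tnth (e c) a; rewrite !(tnth_nth x0).
  have [_ /(_ c) so _] := sys_e.
  apply: (sorted_ltn_nth _ x0 so) => //; rewrite ?inE ?size_tuple //.
  by move=> y x z; apply: ltn_trans.
apply/idP/idP => [|/lt//]; apply: contraTT; rewrite -!leqNgt => qr.
by case: (ltngtP q r) qr => // [/lt/ltnW //|/val_inj->].
Qed.

Lemma mem_chain c d q : (tnth (e d) q \in e c) = (c == d).
Proof.
apply/tnthP/eqP => [[r /chain_inj[-> //]] | ->]; by exists q.
Qed.

Lemma adj_chain c (r q : 'I_n) : q = r.+1 :> nat ->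
  adj (chain_graph e) (tnth (e c) r) (tnth (e c) q).
Proof. by move=> qr; apply/imsetP; exists (c, (r, q)); rewrite ?inE ?qr. Qed.

(** Each chain is closed under adjacency and is connected by its own edges. *)
Lemma same_comp_chain c r d q :
  same_comp (chain_graph e) (tnth (e c) r) (tnth (e d) q) = (c == d).
Proof.
apply/idP/eqP => [|<-{d}].
  have cl : closed (adj (chain_graph e)) (mem (e c)).
    move=> x y /imsetP[[d1 [r1 q1]] _ /= E].
    have /set2P[->|->] : x \in [set tnth (e d1) r1; tnth (e d1) q1].
    - by rewrite -E set21.
    - have /set2P[->|->] : y \in [set tnth (e d1) r1; tnth (e d1) q1];
        by rewrite -?E ?set22 ?mem_chain.
    have /set2P[->|->] : y \in [set tnth (e d1) r1; tnth (e d1) q1];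
      by rewrite -?E ?set22 ?mem_chain.
  by move/(closed_connect cl); rewrite !mem_chain eqxx => /esym/eqP.
wlog rq : r q / (r <= q)%N.
  by move=> H; case/orP: (leq_total r q) => /H //; rewrite /same_comp same_comp_sym.
have [k] := ubnP (q - r)%N; elim: k q rq => // k IH q rq qk.
case: (ltngtP r q) rq => // [rq _|/val_inj-> _]; last exact: connect0.
have q1n : (q.-1 < n)%N by have := ltn_ord q; lia.
apply: (connect_trans (y := tnth (e c) (Ordinal q1n))).
  by apply: IH => /=; lia.
by apply/connect1/adj_chain => /=; lia.
Qed.

Lemma rank_chain c r : rank (chain_graph e) (tnth (e c) r) = r.
Proof.
rewrite /rank cardsE -sum1_card (big_chains chain_bij) /=.
rewrite (bigD1 c) //= [X in (_ + X)%N]big1 ?addn0 => [|d dc].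
  rewrite -[RHS](@card_ord r) -sum1_card (big_ord_widen n (fun=> 1%N)) ?(ltnW (ltn_ord r)) //.
  by apply: eq_bigl => q; rewrite unfold_in /= same_comp_chain eqxx chain_lt.
by rewrite big_pred0 // => q; rewrite unfold_in /= same_comp_chain eq_sym (negPf dc).
Qed.

Lemma path_component_chain C (s : n.-tuple 'I_m) :
  path_component (chain_graph e) C s -> exists c, s = e c.
Proof.
case/and4P => /imsetP[i _ CE] /eqP Cs so _.
have [c [r iE]] := chain_vertex i; exists c; apply/val_inj => /=.
apply: (irr_sorted_eq (leT := fun x y : 'I_m => (x < y)%N)) => //.
- by move=> y x z; apply: ltn_trans.
- by move=> x /=; rewrite ltnn.
- by have [_ ->] := sys_e.
move=> x; move/setP/(_ x): Cs; rewrite CE !inE => <-.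
by have [d [q ->]] := chain_vertex x; rewrite iE same_comp_chain mem_chain.
Qed.

Lemma chain_graph_wave : wave_graph n (chain_graph e).
Proof.
have [_ so nc] := sys_e.
apply/and3P; split.
- apply/forall_inP => E /imsetP[[c [r q]] + ->]; rewrite inE /= => /eqP qr.
  rewrite cards2; case: (tnth (e c) r =P _) => // /chain_inj[_ rq].
  by move: qr; rewrite rq; lia.
- apply/forall_inP => C CG; case/imsetP: (CG) => i _ CE.
  have [c [r iE]] := chain_vertex i; apply/existsP; exists (e c).
  have memC d q : (tnth (e d) q \in C) = (c == d).
    by rewrite CE inE iE same_comp_chain.
  rewrite /path_component CG so /=; apply/andP; split.
    apply/eqP/setP => x; have [d [q ->]] := chain_vertex x.
    by rewrite memC inE mem_chain.
  apply/eqP/setP => E; rewrite inE; apply/andP/imsetP.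
    case=> /imsetP[[d [a b]] + ->] /=; rewrite inE /= => ab.
    move/subsetP/(_ (tnth (e d) a)); rewrite set21 memC => /(_ isT) /eqP <-.
    by exists (a, b); rewrite ?inE.
  case=> [[a b] + ->]; rewrite inE /= => ab; split.
    by apply/imsetP; exists (c, (a, b)); rewrite ?inE.
  by apply/subsetP => x /set2P[]->; rewrite memC.
apply/'forall_'forall_'forall_'forall_implyP => C D s t /andP[].
by move=> /path_component_chain[c ->] /path_component_chain[d ->].
Qed.

End ChainSystem.

(** Together with [chain_graph_wave]: wave graphs are exactly the partitions of
    the vertices into noncrossing increasing n-tuples. *)
Lemma wave_graph_chains n m (G : graph m) : wave_graph n G ->
  exists2 e : {C | C \in components G} -> n.-tuple 'I_m,
    chain_system e & G = chain_graph e.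
Proof.
case/and3P => /forall_inP simpG /forall_inP compG /forallP ncG.
have /fin_all_exists[e eP] (c : {C | C \in components G}) :
    exists s : n.-tuple 'I_m, path_component G (val c) s.
  by apply/existsP/compG/(valP c).
have inC (i : 'I_m) : [set j | same_comp G i j] \in components G.
  exact: imset_f.
have memE c i : (i \in e c) = (i \in val c).
  by case/and4P: (eP c) => _ /eqP-> _ _; rewrite inE.
have compE (c : {C | C \in components G}) i :
    i \in val c -> val c = [set j | same_comp G i j].
  case: c => C /= /imsetP[k _ ->]; rewrite inE => ki; apply/setP => j.
  by rewrite !inE; apply: (same_connect (same_comp_sym G)).
have sys : chain_system e.
  split=> [|c|c d]; last 2 first.
  - by case/and4P: (eP c).
  - have /forallP/(_ (val d))/'forall_'forall_implyP := ncG (val c).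
    by apply; rewrite !eP.
  have uni c : uniq (e c).
    case/and4P: (eP c) => _ _ so _; apply: (sorted_uniq _ _ so).
      by move=> y x z; apply: ltn_trans.
    by move=> x /=; rewrite ltnn.
  apply: inj_card_bij.
    move=> [c r] [d q] /= H.
    have cd : c = d.
      apply/val_inj; rewrite (compE c (tnth (e c) r)) -?memE ?mem_tnth //.
      by rewrite (compE d (tnth (e d) q)) -?memE ?mem_tnth // H.
    rewrite -cd in H *; congr (_, _); apply/eqP.
    by rewrite -(inj_eq (tuple_uniqP _ (uni c))) H.
  have -> : #|'I_m| = #|codom (fun p : {C | C \in components G} * 'I_n => tnth (e p.1) p.2)|.
    apply/esym/eq_card => i; rewrite inE; apply/codomP.
    have : i \in e (exist (fun C => C \in components G) _ (inC i)) by rewrite memE inE; apply: connect0.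
    by case/tnthP => r ->; exists (exist (fun C => C \in components G) _ (inC i), r).
  by rewrite leq_image_card.
exists e => //; apply/setP => E; apply/idP/imsetP.
  move=> EG; have /cards2P[i [j [ij EE]]] := simpG _ EG.
  pose c : {C | C \in components G} := exist (fun C => C \in components G) _ (inC i).
  have /and4P[_ _ _ /eqP/setP/(_ E)] := eP c.
  have -> : E \in [set E' in G | E' \subset val c].
    rewrite inE EG; apply/subsetP => x; rewrite EE => /set2P[]->; rewrite inE.
      exact: connect0.
    by apply: connect1; rewrite /adj -EE.
  by case/esym/imsetP => p pP ->; exists (c, p) => //; move: pP; rewrite !inE.
case=> [[c p] pP ->]; have /and4P[_ _ _ /eqP/setP] := eP c.
move/(_ [set tnth (e c) p.1; tnth (e c) p.2]); rewrite [RHS]imset_f //.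
  by rewrite inE => /andP[].
by move: pP; rewrite !inE.
Qed.

(** * The coefficients of t_G *)

Section WordOrder.
Variables (n m : nat) (G : graph m) (w : {ffun 'I_m -> 'I_n}).

Definition word_order : {set 'I_m * 'I_m} :=
  [set p | same_comp G p.1 p.2 & (w p.1 <= w p.2)%N].

Definition comp_injective : Prop :=
  forall i j, same_comp G i j -> w i = w j -> i = j.

Lemma word_order_ordering : comp_injective -> word_order \in orderings G.
Proof.
move=> winj; rewrite inE; apply/and5P; split.
- by apply/'forall_'forall_implyP => i j; rewrite inE => /andP[].
- by apply/forallP => i; rewrite inE /= leqnn andbT; apply: connect0.
- apply/'forall_'forall_implyP => i j; rewrite !inE /= -!andbA => /and4P[ij le1 _ le2].
  by apply/eqP/winj => //; apply/val_inj/eqP; rewrite eqn_leq le1.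
- apply/'forall_'forall_'forall_implyP => i j k.
  rewrite !inE /= -!andbA => /and4P[ij le1 jk le2].
  by rewrite (leq_trans le1 le2) andbT; apply: connect_trans ij jk.
apply/'forall_'forall_implyP => i j ij.
by rewrite !inE /= ij /same_comp same_comp_sym [connect _ _ _]ij leq_total.
Qed.

(** An ordering g of the components contributes to the coefficient of t_G at w
    only if each vertex i is at position w i of its component, which forces g to
    be [word_order]; so each coefficient has at most one contribution. *)
Lemma ordering_of_word g : g \in orderings G ->
  (forall i, (w i).+1 = ordinal_number g i) -> g = word_order /\ comp_injective.
Proof.
rewrite inE => /and5P[/'forall_'forall_implyP gsc /forallP grefl].
move=> /'forall_'forall_implyP ganti /'forall_'forall_'forall_implyP gtrans.
move=> /'forall_'forall_implyP gtotal wE.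
have sub i j : (i, j) \in g ->
    [set k | (k, i) \in g] \subset [set k | (k, j) \in g].
  move=> ij; apply/subsetP => k; rewrite !inE => ki.
  by apply: (gtrans k i); rewrite ki ij.
have mono i j : (i, j) \in g -> (w i <= w j)%N.
  by move=> /sub/subset_leq_card; rewrite -!/(ordinal_number g _) -!wE.
(* Equal positions mean that the two sets of predecessors coincide. *)
have strict i j : (i, j) \in g -> w i = w j -> i = j.
  move=> ij wij; apply/eqP/ganti; rewrite ij /=.
  have /eqP/setP/(_ j) :
      [set k | (k, i) \in g] == [set k | (k, j) \in g].
    by rewrite eqEcard (sub _ _ ij) -!/(ordinal_number g _) -!wE wij leqnn.
  by rewrite !inE grefl.
have winj : comp_injective.
  move=> i j ij wij; case/orP: (gtotal _ _ ij) => /strict -> //.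
split=> //; apply/setP => [[i j]]; rewrite inE /=; apply/idP/andP => [ij|[ij le]].
  by split; [apply: gsc | apply: mono].
case/orP: (gtotal _ _ ij) => // ji.
by rewrite (strict _ _ ji) ?grefl //; apply/val_inj/eqP; rewrite eqn_leq le mono.
Qed.

End WordOrder.

Section WaveTensor.
Variables (F : fieldType) (n m : nat) (K : finType) (e : K -> n.-tuple 'I_m).
Hypothesis sys_e : chain_system e.
Implicit Type w : {ffun 'I_m -> 'I_n}.

Local Notation G := (chain_graph e).
Local Notation bij_e := (chain_bij sys_e).
Local Notation same_chain := (same_comp_chain sys_e).

Lemma word_order_number w i : comp_injective G w ->
  ordinal_number (word_order G w) i = (w i).+1.
Proof.
move=> winj; have [c [r ->]] := chain_vertex sys_e i.
rewrite /ordinal_number -sum1_card (big_chains bij_e) /=.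
rewrite (bigD1 c) //= [X in (_ + X)%N]big1 ?addn0 => [|d dc]; last first.
  by rewrite big_pred0 // => q; rewrite !inE /= same_chain (negPf dc).
have winj_c : injective (fun q => w (tnth (e c) q)).
  by move=> q q' /winj H; case: (chain_inj sys_e (H _)) => //; rewrite same_chain.
have [f fK Kf] := injF_bij winj_c.
rewrite (reindex f) /=; last by exists (fun q => w (tnth (e c) q)) => q _.
rewrite -[RHS](@card_ord (w (tnth (e c) r)).+1) -sum1_card.
rewrite (big_ord_widen n (fun=> 1%N)) ?ltn_ord //; apply: eq_bigl => q.
by rewrite !inE /= same_chain eqxx Kf.
Qed.

Lemma sign_inversions w : comp_injective G w ->
  (-1) ^+ inversions G (word_order G w) =
  \prod_c word_sign (fun r => w (tnth (e c) r)) :> int.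
Proof.
move=> winj; pose sg (i j : 'I_m) : int := Num.sg ((w j)%:Z - (w i)%:Z).
transitivity (\prod_(i < m) \prod_(j < m | (i < j)%N && same_comp G i j) sg i j).
  rewrite /inversions -prodr_const pair_big_dep /= big_mkcond /=.
  rewrite [RHS]big_mkcond; apply: eq_bigr => -[i j] _; rewrite !inE /=.
  case: (ltnP i j) => //= ij; case: (boolP (same_comp G i j)) => //= sij.
  rewrite /same_comp same_comp_sym [connect _ _ _]sij /= /sg.
  have [ji|ij'] := leqP (w j) (w i).
    rewrite ltr0_sg // subr_lt0 ltz_nat ltn_neqAle ji andbT.
    by apply: contraTneq ij => /val_inj/esym/winj->; rewrite ?ltnn.
  by rewrite gtr0_sg // subr_gt0 ltz_nat.
rewrite (big_chains bij_e); apply: eq_bigr => c _; apply: eq_bigr => r _.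
rewrite (big_chains bij_e) (bigD1 c) //= [X in _ * X]big1 ?mulr1 => [|d dc].
  by apply: eq_bigl => q; rewrite (chain_lt sys_e) same_chain eqxx andbT.
by rewrite big_pred0 // => q; rewrite same_chain eq_sym (negPf dc) andbF.
Qed.

Lemma t_tensorE w :
  t_tensor F n G w = (\prod_c word_sign (fun r => w (tnth (e c) r)))%:~R.
Proof.
have termE g : ((-1) ^+ inversions G g *: b_tensor F n g) w =
    (-1) ^+ inversions G g * [forall i, (w i).+1 == ordinal_number g i]%:R.
  rewrite !ffunE; congr (_ * _).
  case: (boolP [forall i, _]) => [/forallP H | ].
    by rewrite big1 // => i _; rewrite mxE H.
  by case/forallPn => i Hi; rewrite (bigD1 i) //= mxE (negPf Hi) mul0r.
have in_comp : comp_injective G w <-> (forall c, injective (fun r => w (tnth (e c) r))).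
  split=> [winj c q q' /winj H|winj i j].
    by case: (chain_inj sys_e (H _)) => //; rewrite same_chain.
  have [c [r ->]] := chain_vertex sys_e i; have [d [q ->]] := chain_vertex sys_e j.
  by rewrite same_chain => /eqP<- /winj->.
rewrite sum_ffunE.
case: (boolP [forall c, injectiveb (fun r => w (tnth (e c) r))]) => [/forallP H|].
  have winj : comp_injective G w by apply/in_comp => c; apply/injectiveP/H.
  rewrite (bigD1 (word_order G w)) ?word_order_ordering //= big1 ?addr0.
    rewrite termE -(sign_inversions winj) rmorphXn rmorphN1.
    have -> : [forall i, (w i).+1 == ordinal_number (word_order G w) i].
      by apply/forallP => i; rewrite word_order_number.
    by rewrite mulr1.
  move=> g /andP[gG gw]; rewrite termE; case: (boolP [forall i, _]); last by rewrite mulr0.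
  move=> /forallP gE; case/eqP: gw.
  by have [] := ordering_of_word gG (fun i => eqP (gE i)).
case/forallPn => c ninj.
rewrite big1 => [|g gG].
  have /injectivePn[r [q rq wrq]] := ninj.
  by rewrite (bigD1 c) //= (word_sign_eq0 rq wrq) mul0r.
rewrite termE; case: (boolP [forall i, _]); last by rewrite mulr0.
move=> /forallP gE; case/injectiveP: ninj.
by have [_ /in_comp] := ordering_of_word gG (fun i => eqP (gE i)); apply.
Qed.

Lemma t_tensor_invariant : SL_invariant (t_tensor F n G).
Proof.
apply: (block_det_invariant bij_e) => w.
by rewrite t_tensorE rmorph_prod; apply: eq_bigr => c _; rewrite det_word.
Qed.

Lemma t_tensor_label w : (forall c r, w (tnth (e c) r) = r) ->
  t_tensor F n G w = 1.
Proof.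
move=> wE; rewrite t_tensorE big1 // => c _.
rewrite -[RHS]/((-1) ^+ false : int) -(odd_perm1 'I_n) -word_sign_perm.
by apply: eq_bigr => r _; apply: eq_bigr => q _; rewrite !wE !perm1.
Qed.

(** At the first vertex k, say the r-th of its chain, where u differs from w,
    a letter q < r repeats the letter of the q-th vertex of that chain. *)
Lemma t_tensor_support w u : (forall c r, w (tnth (e c) r) = r) ->
  t_tensor F n G u != 0 -> ~ lexlt u w.
Proof.
move=> wE tu [k kw ukw]; case/eqP: tu; move: kw ukw.
have [c [r ->]] := chain_vertex sys_e k; rewrite wE; set q := u _ => kw qr.
rewrite t_tensorE (bigD1 c) //= (@word_sign_eq0 _ _ q r) ?mul0r //.
  by apply: contraTneq qr => ->; rewrite ltnn.
by rewrite kw ?(chain_lt sys_e) ?wE.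
Qed.

End WaveTensor.

(** * Matching brackets *)

Section Dyck.
Local Open Scope nat_scope.
Variables (n m : nat) (w : {ffun 'I_m -> 'I_n}).

Lemma occ1 r (k : 'I_m) : occ w r k k.+1 = (w k == r :> nat).
Proof.
rewrite /occ (bigD1 k) //= leqnn ltnSn !andbT big1 ?addn0 // => p pk.
by apply/eqP; rewrite eqb0; apply: contra pk => /and3P[_ ? ?]; apply/eqP/val_inj => /=; lia.
Qed.

Lemma occ_step r a (k : 'I_m) : (a <= k)%N ->
  occ w r a k.+1 = (occ w r a k + (w k == r :> nat))%N.
Proof. by move=> ak; rewrite (@occ_cat _ _ _ _ a k) ?occ1 //; lia. Qed.

Lemma occ_split r a (k : 'I_m) b : (a <= k < b)%N ->
  occ w r a b = (occ w r a k + (w k == r :> nat) + occ w r k.+1 b)%N.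
Proof. by move=> akb; rewrite -occ_step -?occ_cat //; lia. Qed.

Lemma occ0 r a : occ w r a a = 0%N.
Proof. by rewrite /occ big1 // => p _; lia. Qed.

(** With N = w i as opening and N+1 as closing bracket: j closes the bracket
    opened at i. *)
Definition dyck (i j : 'I_m) : bool :=
  [&& w j == (w i).+1 :> nat, (i < j)%N,
      [forall t : 'I_m, (i < t <= j)%N ==>
         (occ w (w i).+1 i.+1 t <= occ w (w i) i.+1 t)%N]
    & occ w (w i) i.+1 j == occ w (w i).+1 i.+1 j].

Lemma dyckP (i j : 'I_m) : reflect
  [/\ w j = (w i).+1 :> nat, (i < j)%N,
      forall t, (i < t <= j)%N ->
         (occ w (w i).+1 i.+1 t <= occ w (w i) i.+1 t)%N
    & occ w (w i) i.+1 j = occ w (w i).+1 i.+1 j] (dyck i j).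
Proof.
apply: (iffP and4P) => [[/eqP ? ? /forallP H /eqP ?]|[-> ij H ->]]; split=> //.
  move=> t it; have tm : (t < m)%N by have := ltn_ord j; lia.
  by apply: (implyP (H (Ordinal tm))).
by apply/forallP => t; apply/implyP/H.
Qed.

(** Just after the first of two closing brackets j < j', closing brackets would
    outnumber opening ones. *)
Lemma dyck_functional i j j' : dyck i j -> dyck i j' -> j = j'.
Proof.
wlog lt : j j' / (j < j')%N.
  move=> H ij ij'; case: (ltngtP j j') => [/H->|/H ->|/val_inj] //.
move=> /dyckP[wj ij _ E] /dyckP[_ ij' /(_ j.+1) le _].
have := le ltac:(lia).
by rewrite !occ_step ?E ?wj //; lia.
Qed.

(** If i < i' were closed by the same j, then, as the brackets enclosed by i and j
    and those enclosed by i' and j are balanced, the bracket i' would be offset by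
    an excess of closing brackets between i and i'. *)
Lemma dyck_injective i i' j : dyck i j -> dyck i' j -> i = i'.
Proof.
wlog lt : i i' / (i < i')%N.
  move=> H ij ij'; case: (ltngtP i i') => [/H->|/H ->|/val_inj] //.
move=> /dyckP[wj ij /(_ i') le E] /dyckP[wj' ij' _ E'].
have wi : w i' = w i :> nat by lia.
have := le ltac:(lia); move: E E'; rewrite wi.
by rewrite !(@occ_split _ i.+1 i' j) ?wi; lia.
Qed.

(** In a crossing i < j < i' < j', the brackets enclosed by i and i' are balanced and
    include the opening bracket j, so between j and i' closing brackets would be in
    excess, although j is closed only later, by j'. *)
Lemma dyck_noncrossing i i' j j' : w i = w j ->
  dyck i i' -> dyck j j' -> ~~ [&& (i < j)%N, (j < i')%N & (i' < j')%N].
Proof.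
move=> wij /dyckP[wi' ii' le E] /dyckP[_ _ le' _]; apply/negP => /and3P[ij ji' ij'].
have := le' i'.+1 ltac:(lia); have := le j ltac:(lia); move: E.
rewrite !(@occ_split _ i.+1 j i') ?(@occ_step _ j.+1 i') -?wij ?wi'; lia.
Qed.

Hypotheses (lat_w : lattice w) (bal_w : balanced w).

(** Let the height H(t) be the excess of letters N over N+1 among the first t.
    The bracket opened at i is closed where the height first returns to H(i);
    it does so because H is nonnegative and ends at 0. *)
Lemma dyck_right i : ((w i).+1 < n)%N -> exists j, dyck i j.
Proof.
move=> rn; set r := nat_of_ord (w i) in rn.
pose P t := (i < t)%N && (occ w r 0 t + occ w r.+1 0 i <= occ w r.+1 0 t + occ w r 0 i)%N.
have Pm : P m.
  by rewrite /P ltn_ord bal_w //; have := @lat_w r i rn; lia.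
case: (ex_minnP (ex_intro P m Pm)) => t /andP[it Pt] tmin.
have tm := tmin m Pm.
have ti : t != i.+1.
  by apply: contraTneq Pt => ->; rewrite !occ_step //; lia.
have jm : (t.-1 < m)%N by lia.
pose j := Ordinal jm; have jE : t = j.+1 by rewrite /=; lia.
have nP s : (i < s)%N -> (s <= j)%N ->
    (occ w r.+1 0 s + occ w r 0 i < occ w r 0 s + occ w r.+1 0 i)%N.
  move=> is_ sj; rewrite ltnNge; apply/negP => Q.
  by have := tmin s; rewrite /P is_ Q => /(_ isT); lia.
have ij : (i < j)%N by rewrite /=; lia.
have := nP j ij (leqnn _); rewrite jE !occ_step // in Pt => nPj.
have wj : w j = r.+1 :> nat by lia.
exists j; apply/dyckP; rewrite -/r; split=> //.
  move=> s /andP[is_ sj]; have := nP s is_ sj.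
  by rewrite !(@occ_split _ 0 i s) //; lia.
by move: Pt nPj; rewrite !(@occ_split _ 0 i j) //; lia.
Qed.

(** The bracket closed at j is opened at the last t with H(t) <= H(j+1), which
    exists as H(0) = 0 <= H(j+1). *)
Lemma dyck_left j : (0 < w j)%N -> exists i, dyck i j.
Proof.
move=> wj0; pose r := (w j).-1; have wj : w j = r.+1 :> nat by rewrite /r; lia.
have rn : (r.+1 < n)%N by rewrite -wj.
pose P t := (t <= j)%N &&
  (occ w r 0 t + occ w r.+1 0 j.+1 <= occ w r.+1 0 t + occ w r 0 j.+1)%N.
have P0 : P 0%N by rewrite /P !occ0; have := @lat_w r j.+1 rn; lia.
have Pj t : P t -> (t <= j)%N by case/andP.
case: (ex_maxnP (ex_intro P 0%N P0) Pj) => t /andP[tj Pt] tmax.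
have tj' : (t < j)%N.
  rewrite ltn_neqAle tj andbT; apply: contraTneq Pt => ->.
  by rewrite !occ_step //; lia.
have tm : (t < m)%N by have := ltn_ord j; lia.
pose i := Ordinal tm.
have nP s : (t < s)%N -> (s <= j)%N ->
    (occ w r.+1 0 s + occ w r 0 j.+1 < occ w r 0 s + occ w r.+1 0 j.+1)%N.
  move=> ts sj; rewrite ltnNge; apply/negP => Q.
  by have := tmax s; rewrite /P sj Q => /(_ isT); lia.
have ni := nP i.+1 (leqnn _) tj'; rewrite -[t]/(i : nat) in Pt.
have wi : w i = r :> nat by move: ni Pt; rewrite !(@occ_step _ 0 i) //; lia.
exists i; apply/dyckP; rewrite wi; split=> //.
  move=> s /andP[is_ sj]; have := nP s is_ sj; move: Pt ni.
  by rewrite !(@occ_split _ 0 i s) // !(@occ_step _ 0 i) //; lia.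
move: Pt ni; have := nP j tj' (leqnn _).
by rewrite !(@occ_step _ 0 j) // !(@occ_split _ 0 i j) // !(@occ_step _ 0 i) //; lia.
Qed.

(** The chains start at the letters 0 of w and follow the matching brackets;
    going backwards from any vertex i reaches a letter 0 after w i steps. *)
Lemma lattice_chains : exists (K : finType) (e : K -> n.-tuple 'I_m),
  chain_system e /\ forall c r, w (tnth (e c) r) = r.
Proof.
have /fin_all_exists[nx nxP] i : exists j, ((w i).+1 < n)%N -> dyck i j.
  case: ltnP => [/dyck_right[j ij]|_]; first by exists j.
  by exists i.
have /fin_all_exists[pv pvP] j : exists i, (0 < w j)%N -> dyck i j.
  case: posnP => [_|/dyck_left[i ij]]; last by exists i.
  by exists j.
have w_nx i : ((w i).+1 < n)%N -> w (nx i) = (w i).+1 :> nat.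
  by case/nxP/dyckP.
have w_pv j : (0 < w j)%N -> w (pv j) = (w j).-1 :> nat.
  by case/pvP/dyckP => -> .
have nxK i : ((w i).+1 < n)%N -> pv (nx i) = i.
  move=> wi; apply: (dyck_injective (j := nx i)); last exact: nxP.
  by apply: pvP; rewrite w_nx.
have pvK j : (0 < w j)%N -> nx (pv j) = j.
  move=> wj; apply: (dyck_functional (i := pv j)); last exact: pvP.
  by apply: nxP; rewrite w_pv // prednK.
have w_iter k i : w i = 0 :> nat -> (k < n)%N -> w (iter k nx i) = k :> nat.
  by move=> wi; elim: k => //= k IH kn; rewrite w_nx IH //; lia.
have iter_pv k i : (k <= w i)%N ->
    w (iter k pv i) = w i - k :> nat /\ iter k nx (iter k pv i) = i.
  elim: k => [|k IH] kw; first by rewrite subn0.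
  have [wk ik] := IH (ltnW kw).
  rewrite [iter k.+1 nx _]iterSr [iter k.+1 pv i]iterS pvK ?wk ?subn_gt0 //.
  by rewrite w_pv wk ?subn_gt0 // -subnS.
have iter_nx k i : w i = 0 :> nat -> (k < n)%N -> iter k pv (iter k nx i) = i.
  move=> wi; elim: k => // k IH kn; rewrite iterSr /= nxK; first by apply: IH; lia.
  by rewrite w_iter //; lia.
pose K := {c : 'I_m | w c == 0 :> nat}.
pose e (c : K) : n.-tuple 'I_m := [tuple iter r nx (val c) | r < n].
have eE c r : tnth (e c) r = iter r nx (val c) by rewrite tnth_mktuple.
have we c r : w (tnth (e c) r) = r.
  by apply/val_inj; rewrite eE /= w_iter //; apply/eqP/(valP c).
exists K, e; split=> //.
have dy c (r q : 'I_n) : q = r.+1 :> nat -> dyck (tnth (e c) r) (tnth (e c) q).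
  move=> qr; rewrite !eE qr /=; apply: nxP; rewrite -eE we -qr //.
split=> [|c|c d].
- have root_w i : w (iter (w i) pv i) == 0 :> nat.
    by have [-> _] := iter_pv (w i) i (leqnn _); rewrite subnn.
  exists (fun i => (exist (fun c : 'I_m => w c == 0 :> nat) _ (root_w i), w i)).
    move=> [c r] /=; congr (_, _); last exact: we.
    by apply/val_inj; rewrite /= we eE iter_nx //; apply/eqP/(valP c).
  by move=> i; rewrite eE /=; have [_ ->] := iter_pv (w i) i (leqnn _).
- case: (n) (e c) (dy c) => [|n'] s dys; first by rewrite tuple0.
  move: (tnth s ord0) => x0; apply/(sortedP x0) => k; rewrite size_tuple => kn.
  have /dyckP[_ + _ _] := dys (inord k) (inord k.+1) ltac:(rewrite !inordK //; lia).
  by rewrite !(tnth_nth x0) !inordK //; lia.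
apply/'forall_'forall_implyP => N N' /eqP NN'.
by apply: dyck_noncrossing; rewrite ?we ?dy.
Qed.

End Dyck.

Section ChainDyck.
Local Open Scope nat_scope.
Variables (n m : nat) (K : finType) (e : K -> n.-tuple 'I_m).
Variable w : {ffun 'I_m -> 'I_n}.
Hypotheses (sys_e : chain_system e) (we : forall c r, w (tnth (e c) r) = r).

Lemma occ_chains (r : 'I_n) a b :
  occ w r a b = (\sum_c (a <= tnth (e c) r < b)%N)%N.
Proof.
rewrite /occ (big_chains (chain_bij sys_e)) /=; apply: eq_bigr => c _.
rewrite (bigD1 r) //= we eqxx big1 ?addn0 // => q /negPf qr.
by rewrite we val_eqE qr.
Qed.

(** As edges on one page do not cross, the edge of another chain on the page of
    r and q ends strictly between the ends of the edge of c if and only if it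
    starts there; so the letters r and q enclosed by the latter are matched
    among themselves. *)
Lemma chain_dyck c (r q : 'I_n) : q = r.+1 :> nat ->
  dyck w (tnth (e c) r) (tnth (e c) q).
Proof.
move=> qr; have [_ _ nc] := sys_e.
have crossF d d' : ~~ [&& (tnth (e d) r < tnth (e d') r)%N,
    (tnth (e d') r < tnth (e d) q)%N & (tnth (e d) q < tnth (e d') q)%N].
  by have /'forall_'forall_implyP := nc d d'; apply; rewrite qr.
have rq d : (tnth (e d) r < tnth (e d) q)%N by rewrite (chain_lt sys_e) qr.
have ne s d : d != c -> tnth (e d) s != tnth (e c) s :> nat.
  by apply: contraNneq => /val_inj/(chain_inj sys_e)[->].
have le t : (tnth (e c) r < t <= tnth (e c) q)%N ->
    (occ w q (tnth (e c) r).+1 t <= occ w r (tnth (e c) r).+1 t)%N.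
  move=> tb; rewrite !occ_chains; apply: leq_sum => d _.
  case: (eqVneq d c) => [->|dc]; first lia.
  by move: (crossF d c) (rq d) (ne r d dc); lia.
apply/dyckP; rewrite !we -qr; split=> //.
rewrite !occ_chains; apply: eq_bigr => d _.
case: (eqVneq d c) => [->|dc]; first lia.
by move: (crossF d c) (crossF c d) (rq d) (ne r d dc) (ne q d dc); lia.
Qed.

Lemma chain_graph_dyck :
  chain_graph e = [set [set p.1; p.2] | p in [set p | dyck w p.1 p.2]].
Proof.
apply/setP => E; apply/imsetP/imsetP => -[].
  move=> [c [r q]]; rewrite inE /= => /eqP qr ->.
  by exists (tnth (e c) r, tnth (e c) q); rewrite ?inE ?chain_dyck.
move=> [i j]; rewrite inE /= => ij ->.
have [c [r iE]] := chain_vertex sys_e i; rewrite iE in ij *.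
have /dyckP[wj _ _ _] := ij; have rn : (r.+1 < n)%N.
  by rewrite -(we c r) -wj.
exists (c, (r, Ordinal rn)); rewrite ?inE //=.
by rewrite (dyck_functional ij (@chain_dyck c r (Ordinal rn) _)).
Qed.

End ChainDyck.

(** * Triangular families of tensors *)

Section Lex.
Variables (n m : nat).

Definition lexkey (w : {ffun 'I_m -> 'I_n}) : m.-tuplelexi 'I_n :=
  [tuple w k | k < m].

Lemma lexltP u w : reflect (lexlt u w) (lexkey u < lexkey w)%O.
Proof.
apply: (iffP (Order.TupleLexiOrder.Exports.ltxi_tuplePlt)) => -[k].
  move=> eqk ltk; exists k.
    by move=> j /eqk; rewrite !tnth_mktuple.
  by move: ltk; rewrite !tnth_mktuple.
move=> eqk ltk; exists k; last by rewrite !tnth_mktuple.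
by move=> j jk; rewrite !tnth_mktuple eqk.
Qed.

Lemma lexkey_inj : injective lexkey.
Proof.
move=> u w /(congr1 (fun t : m.-tuple 'I_n => tnth t)) E; apply/ffunP => k.
by have := congr1 (fun f => f k) E; rewrite !tnth_mktuple.
Qed.
End Lex.

Section Triangular.
Variables (F : fieldType) (n m : nat) (I : finType) (P : pred I).
Variables (x : I -> tensor F n m) (l : I -> {ffun 'I_m -> 'I_n}).
Hypothesis l_inj : {in P &, injective l}.
Hypothesis x_lead : forall i, P i -> x i (l i) = 1.
Hypothesis x_supp : forall i u, P i -> x i u != 0 ->
  (lexkey (l i) <= lexkey u)%O.

(** Evaluate a linear relation at the least leading word l(i) with nonzero
    coefficient: all other terms vanish there. *)
Lemma triangular_free : free [seq x i | i in P].
Proof.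
rewrite -[[seq x i | i in P]]/(val (in_tuple [seq x i | i in P])).
apply/freeP => k k0 j; apply/eqP/negP => /negP kj.
have sz : size [seq x i | i in P] = #|P| by rewrite size_map -cardE.
pose g (a : 'I_(size [seq x i | i in P])) : I := enum_val (cast_ord sz a).
have Pg a : P (g a) := enum_valP (cast_ord sz a).
have g_inj : injective g by move=> a b /enum_val_inj/cast_ord_inj.
have xE (a : 'I_(size [seq x i | i in P])) : (in_tuple [seq x i | i in P])`_a = x (g a).
  rewrite (nth_map (g a)) /=; last by rewrite -cardE -sz ltn_ord.
  by congr x; rewrite [RHS](enum_val_nth (g a)).
case: (@Order.TotalTheory.arg_minP _ _ _ j (fun a => k a != 0) (fun a => lexkey (l (g a))) kj).
move=> a ka amin; case/eqP: (ka).
move/(congr1 (fun T : tensor F n m => T (l (g a)))): k0.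
rewrite /= sum_ffunE ffunE (bigD1 a) //= big1 ?addr0 => [|b ba].
  by rewrite !ffunE xE x_lead ?Pg //= [_ *: _]mulr1.
rewrite !ffunE xE; case: (eqVneq (k b) 0) => [->|kb]; first exact: mul0r.
apply/eqP; rewrite [_ *: _]/(_ * _) mulf_eq0 (negPf kb) /=; apply/negP => /negP xb.
have le1 := x_supp (Pg b) xb; have le2 := amin b kb.
case/eqP: ba; apply/g_inj/(l_inj (Pg _) (Pg _))/lexkey_inj/le_anti.
by rewrite le1 le2.
Qed.

(** Subtracting the multiple of x i that cancels the least word of T strictly
    shrinks the set of words above the support of T. *)
Lemma triangular_span (Q : tensor F n m -> Prop) :
  (forall T i, P i -> Q T -> Q (T - T (l i) *: x i)) ->
  (forall T w, Q T -> T w != 0 ->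
     (forall u, T u != 0 -> (lexkey w <= lexkey u)%O) -> exists2 i, P i & l i = w) ->
  forall T, Q T -> T \in <<[seq x i | i in P]>>%VS.
Proof.
move=> Qsub Qlead T.
pose above (S : tensor F n m) :=
  [set u | [exists w, (S w != 0) && (lexkey w <= lexkey u)%O]].
have [d] := ubnP #|above T|; elim: d T => // d IH T Td QT.
case: (eqVneq T 0) => [->|T0]; first exact: mem0v.
have [w0 Tw0] : exists w, T w != 0.
  apply/existsP; apply: contraR T0; rewrite negb_exists => /forallP H.
  by apply/eqP/ffunP => w; rewrite ffunE; apply/eqP; rewrite -[_ == _]negbK H.
case: (@Order.TotalTheory.arg_minP _ _ _ w0 (fun w => T w != 0) (@lexkey n m) Tw0).
move=> w Tw wmin; have [i Pi lw] := Qlead T w QT Tw wmin.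
rewrite -[T](subrK (T (l i) *: x i)) memvD //; last first.
  by rewrite memvZ // memv_span //; apply: image_f.
apply: IH (Qsub _ _ Pi QT).
have supp u : (T - T (l i) *: x i) u != 0 -> (lexkey w <= lexkey u)%O && (u != w).
  rewrite !ffunE => H; apply/andP; split.
    case: (eqVneq (T u) 0) => [Tu|/wmin //]; rewrite -lw; apply: (x_supp Pi).
    by apply: contraNneq H => xu; rewrite Tu xu [_ *: _]mulr0 subrr.
  by apply: contraNneq H => ->; rewrite -lw x_lead // [_ *: _]mulr1 subrr.
rewrite -ltnS; apply: leq_trans Td; rewrite ltnS; apply: proper_card.
apply/properP; split.
  apply/subsetP => u; rewrite !inE => /existsP[v /andP[/supp/andP[wv _] vu]].
  by apply/existsP; exists w; rewrite Tw (le_trans wv vu).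
exists w; first by rewrite inE; apply/existsP; exists w; rewrite Tw le_refl.
rewrite inE; apply/existsPn => v; apply/negP => /andP[/supp/andP[wv vw] vw'].
case/eqP: vw; apply/lexkey_inj/le_anti.
by rewrite wv vw'.
Qed.
End Triangular.

(** * The basis of invariants *)

Section LabelWord.
Variables (n' m : nat).
Local Notation n := n'.+1.

Definition label_word (G : graph m) : {ffun 'I_m -> 'I_n} :=
  [ffun i => inord (rank G i)].

Lemma label_chain (K : finType) (e : K -> n.-tuple 'I_m) : chain_system e ->
  forall c r, label_word (chain_graph e) (tnth (e c) r) = r.
Proof. by move=> sys c r; rewrite ffunE rank_chain // inord_val. Qed.

Lemma label_word_inj : {in @wave_graph n m &, injective label_word}.
Proof.
move=> G H /wave_graph_chains[e sys_e GE] /wave_graph_chains[f sys_f HE] wGH.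
have we := label_chain sys_e; have wf := label_chain sys_f.
move: we wf; rewrite -GE -HE -wGH => we wf.
by rewrite GE HE (chain_graph_dyck sys_e we) (chain_graph_dyck sys_f wf).
Qed.

Lemma lattice_label (w : {ffun 'I_m -> 'I_n}) : lattice w -> balanced w ->
  exists2 G, wave_graph n G & label_word G = w.
Proof.
move=> lat bal; have [K [e [sys we]]] := lattice_chains lat bal.
exists (chain_graph e); first exact: chain_graph_wave.
apply/ffunP => i; have [c [r ->]] := chain_vertex sys i.
by rewrite label_chain ?we.
Qed.

End LabelWord.

Theorem theorem1 (F : fieldType) (charF0 : [pchar F] =i pred0)
    (n m : nat) (n_gt0 : (0 < n)%N) :
  exists2 U : {vspace tensor F n m},
    (forall T : tensor F n m, T \in U <-> SL_invariant T)
    & basis_of U [seq t_tensor F n G | G : graph m in @wave_graph n m].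
Proof.
case: n n_gt0 => // n' _; set n := n'.+1; set X := image _ _.
have inv_t (G : graph m) : wave_graph n G -> SL_invariant (t_tensor F n G).
  by case/wave_graph_chains => e sys ->; apply: t_tensor_invariant.
have lead (G : graph m) : wave_graph n G -> t_tensor F n G (label_word n' G) = 1.
  by case/wave_graph_chains => e sys ->; apply/t_tensor_label/label_chain.
have supp (G : graph m) u : wave_graph n G -> t_tensor F n G u != 0 ->
    (lexkey (label_word n' G) <= lexkey u)%O.
  case/wave_graph_chains => e sys -> tu.
  rewrite leNgt; apply/lexltP; move: tu.
  exact/t_tensor_support/label_chain.
exists <<X>>%VS; last first.
  rewrite /basis_of eqxx /=.
  exact: (triangular_free (@label_word_inj n' m) lead supp).
move=> T; split=> [TX|].
  have [c ->] : exists c : 'I_(size X) -> F, T = \sum_i c i *: X`_i.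
    by exists (fun i => coord (in_tuple X) i T); apply: (coord_span (X := in_tuple X)).
  move=> a deta; rewrite tensor_act_sum; apply: eq_bigr => i _; congr (_ *: _).
  have /imageP[G WG ->] : X`_i \in X by apply: mem_nth.
  exact: inv_t.
apply: (triangular_span lead supp) => [{}T G WG invT a deta|{}T w invT Tw wmin].
  have -> : T - T (label_word n' G) *: t_tensor F n G =
      - T (label_word n' G) *: t_tensor F n G + T by rewrite scaleNr addrC.
  by rewrite tensor_act_linear invT // inv_t.
have bal u : T u != 0 -> balanced u := invariant_balanced charF0 invT.
have lat : lattice w.
  apply: (lexmin_lattice invT bal Tw) => u /wmin.
  by rewrite leNgt => /lexltP.
by have [G WG wE] := lattice_label lat (bal w Tw); exists G.
Qed.
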